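(* Every De Morgan groupoid $A$ is isomorphic to $\mathcal{G}_0(\mathcal{F}_0(A))$, the algebra of compact open subsets of the prime spectrum of $A$.
   Context: A De Morgan algebra is a bounded distributive lattice $\langle A;\wedge,\vee,0,1\rangle$ with a unary operation $-$ such that $a\leq b$ implies $-b\leq -a$, and $--a=a$. A De Morgan groupoid is an algebra $\langle A;\wedge,\vee,-,\cdot,\rightarrow,t,0,1\rangle$ such that $\langle A;\wedge,\vee,-,0,1\rangle$ is a De Morgan algebra and, for all $a,b,c\in A$: $t\cdot a=a$; $a\cdot 0=0\cdot a=0$; $a\cdot(b\vee c)=(a\cdot b)\vee(a\cdot c)$; $(a\vee b)\cdot c=(a\cdot c)\vee(b\cdot c)$; and $a\cdot b\leq c$ iff $a\leq b\rightarrow c$. Isomorphisms are with respect to all these operations. The prime spectrum of $A$ is $\mathcal{F}_0(A)=\langle\mathfrak{P}(A);g_A,S_A,\Theta_A,\tau(\beta)\rangle$, where $\mathfrak{P}(A)$ is the set of prime (in particular proper) filters of $A$; $g_A(x)=\{a\in A:-a\notin x\}$; $\Theta_A=\{x\in\mathfrak{P}(A):t\in x\}$; $S_Axyz$ iff $x\odot y\subseteq z$, where $x\odot y=\{c\in A:a\cdot b\leq c\text{ for some }a\in x,\ b\in y\}$; and $\tau(\beta)$ is the topology with basis $\{\phi(a):a\in A\}$, $\phi(a)=\{x\in\mathfrak{P}(A):a\in x\}$. For a topological space $X$ with $g\colon X\to X$, $S\subseteq X^3$ and $\Theta\subseteq X$, $\Omega(X)$ is the set of compact open subsets of $X$, and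 $\mathcal{G}_0(X)=\langle\Omega(X);\cap,\cup,{}^*,\circ,\rightarrow,\Theta,\emptyset,X\rangle$, where $U^*=\{x\in X:g(x)\notin U\}$, $U\circ V=\{z\in X:\exists x,y\,(Sxyz,\ x\in U,\ y\in V)\}$ and $U\rightarrow V=\{x\in X:\forall y,z\,((Sxyz\ \text{and}\ y\in U)\Rightarrow z\in V)\}$. *)

(* Defs.v *)
From HB Require Import structures.
From mathcomp Require Import all_boot all_order.
From mathcomp Require Import all_classical topology.

Set Implicit Arguments.
Unset Strict Implicit.
Unset Printing Implicit Defensive.

Import Order.TTheory.
Local Open Scope classical_set_scope.
Local Open Scope order_scope.

HB.mixin Record isDeMorgan (d : Order.disp_t) A of Order.TBDistrLattice d A := {
  dmneg : A -> A;
  dmneg_anti : forall a b : A, a <= b -> dmneg b <= dmneg a;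
  dmnegK : forall a : A, dmneg (dmneg a) = a
}.

#[short(type="deMorganAlgType")]
HB.structure Definition DeMorganAlg (d : Order.disp_t) :=
  { A of isDeMorgan d A & Order.TBDistrLattice d A }.

(* No associativity, commutativity or right unit law is required of the
   multiplication [dmmul]. *)
HB.mixin Record isDeMorganGroupoid (d : Order.disp_t) A of DeMorganAlg d A := {
  dmmul : A -> A -> A;
  dmimp : A -> A -> A;
  dmunit : A;
  dmunit_mul : forall a : A, dmmul dmunit a = a;
  dmmul0 : forall a : A, dmmul a \bot = \bot;
  dm0mul : forall a : A, dmmul \bot a = \bot;
  dmmulUr : forall a b c : A,
    dmmul a (Order.join b c) = Order.join (dmmul a b) (dmmul a c);
  dmmulUl : forall a b c : A,
    dmmul (Order.join a b) c = Order.join (dmmul a c) (dmmul b c);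
  dmmul_residual : forall a b c : A, (dmmul a b <= c) <-> (a <= dmimp b c)
}.

#[short(type="deMorganGroupoidType")]
HB.structure Definition DeMorganGroupoid (d : Order.disp_t) :=
  { A of isDeMorganGroupoid d A & DeMorganAlg d A }.

(* Algebras in the signature of De Morgan groupoids; no identities are
   imposed, so that the compact opens of an arbitrary frame qualify. *)
Record dmAlgebra := DmAlgebra {
  alg_sort :> Type;
  alg_meet : alg_sort -> alg_sort -> alg_sort;
  alg_join : alg_sort -> alg_sort -> alg_sort;
  alg_neg : alg_sort -> alg_sort;
  alg_mul : alg_sort -> alg_sort -> alg_sort;
  alg_imp : alg_sort -> alg_sort -> alg_sort;
  alg_unit : alg_sort;
  alg_bot : alg_sort;
  alg_top : alg_sort
}.

Record dmHom (A B : dmAlgebra) (f : A -> B) : Prop := DmHom {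
  hom_meet : forall a b, f (alg_meet a b) = alg_meet (f a) (f b);
  hom_join : forall a b, f (alg_join a b) = alg_join (f a) (f b);
  hom_neg : forall a, f (alg_neg a) = alg_neg (f a);
  hom_mul : forall a b, f (alg_mul a b) = alg_mul (f a) (f b);
  hom_imp : forall a b, f (alg_imp a b) = alg_imp (f a) (f b);
  hom_unit : f (alg_unit A) = alg_unit B;
  hom_bot : f (alg_bot A) = alg_bot B;
  hom_top : f (alg_top A) = alg_top B
}.

Definition dmIsomorphic (A B : dmAlgebra) : Prop :=
  exists2 f : A -> B, bijective f & dmHom f.

Definition dmAlgebra_of (d : Order.disp_t) (A : deMorganGroupoidType d) :
    dmAlgebra :=
  @DmAlgebra A Order.meet Order.join dmneg dmmul dmimp dmunit \bot \top.

Record dmFrame := DmFrame {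
  frame_space :> topologicalType;
  frame_g : frame_space -> frame_space;
  frame_S : frame_space -> frame_space -> frame_space -> Prop;
  frame_Theta : set frame_space
}.

Section CompactOpens.
Variable X : dmFrame.
Implicit Types U V : set X.

Definition compact_open U : Prop := compact U /\ open U.

Definition co_neg U : set X := [set x | ~ U (frame_g x)].

Definition co_mul U V : set X :=
  [set z | exists x y, [/\ frame_S x y z, U x & V y]].

Definition co_imp U V : set X :=
  [set x | forall y z, frame_S x y z /\ U y -> V z].

(* In an arbitrary frame these closure properties may fail; they are exactly
   what makes the compact opens an algebra. *)
Record co_closed : Prop := CoClosed {
  co_closedI : forall U V,
    compact_open U -> compact_open V -> compact_open (U `&` V);
  co_closedU : forall U V,
    compact_open U -> compact_open V -> compact_open (U `|` V);
  co_closed_neg : forall U, compact_open U -> compact_open (co_neg U);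
  co_closed_mul : forall U V,
    compact_open U -> compact_open V -> compact_open (co_mul U V);
  co_closed_imp : forall U V,
    compact_open U -> compact_open V -> compact_open (co_imp U V);
  co_closed_unit : compact_open (@frame_Theta X);
  co_closed0 : compact_open set0;
  co_closedT : compact_open setT
}.

Definition G0 (H : co_closed) : dmAlgebra :=
  @DmAlgebra {U : set X | compact_open U}
    (fun u v => exist _ _ (co_closedI H (svalP u) (svalP v)))
    (fun u v => exist _ _ (co_closedU H (svalP u) (svalP v)))
    (fun u => exist _ _ (co_closed_neg H (svalP u)))
    (fun u v => exist _ _ (co_closed_mul H (svalP u) (svalP v)))
    (fun u v => exist _ _ (co_closed_imp H (svalP u) (svalP v)))
    (exist _ _ (co_closed_unit H))
    (exist _ _ (co_closed0 H))
    (exist _ _ (co_closedT H)).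

End CompactOpens.

Record is_prime_filter (d : Order.disp_t) (A : tbDistrLatticeType d)
    (x : set A) : Prop := IsPrimeFilter {
  pf_top : x \top;
  pf_up : forall a b, a <= b -> x a -> x b;
  pf_meet : forall a b, x a -> x b -> x (Order.meet a b);
  pf_proper : ~ x \bot;
  pf_prime : forall a b, x (Order.join a b) -> x a \/ x b
}.

Record primeFilter (d : Order.disp_t) (A : tbDistrLatticeType d) :=
  PrimeFilter { pf_set :> set A ; pf_setP : is_prime_filter pf_set }.

HB.instance Definition _ (d : Order.disp_t) (A : tbDistrLatticeType d) :=
  gen_eqMixin (primeFilter A).
HB.instance Definition _ (d : Order.disp_t) (A : tbDistrLatticeType d) :=
  gen_choiceMixin (primeFilter A).

Section SpectrumTopology.
Variables (d : Order.disp_t) (A : tbDistrLatticeType d).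

Definition phi (a : A) : set (primeFilter A) :=
  [set x : primeFilter A | (x : set A) a].

Lemma phi_cover : \bigcup_(U in range phi) U = setT.
Proof.
apply/seteqP; split=> // x _; exists (phi \top); first by exists \top.
exact: (pf_top (pf_setP x)).
Qed.

Lemma phi_join (U V : set (primeFilter A)) (x : primeFilter A) :
  range phi U -> range phi V -> U x -> V x ->
  exists W, [/\ range phi W, W x & W `<=` U `&` V].
Proof.
move=> [a _ <-] [b _ <-] xa xb; exists (phi (Order.meet a b)); split.
- by exists (Order.meet a b).
- exact: (pf_meet (pf_setP x) xa xb).
- move=> y yab; split.
  + exact: (pf_up (pf_setP y) (leIl a b) yab).
  + exact: (pf_up (pf_setP y) (leIr b a) yab).
Qed.

HB.instance Definition _ :=
  @isBaseTopological.Build (primeFilter A) (set (primeFilter A)) (range phi)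
    id phi_cover phi_join.

End SpectrumTopology.

Section Spectrum.
Variables (d : Order.disp_t) (A : deMorganGroupoidType d).
Implicit Types x y z : primeFilter A.

Definition spec_g_set x : set A := [set a | ~ (x : set A) (dmneg a)].

Lemma dmneg_bot : dmneg (\bot : A) = \top.
Proof. by apply/eqP; rewrite -le1x -[leLHS]dmnegK dmneg_anti// le0x. Qed.

Lemma dmneg_top : dmneg (\top : A) = \bot.
Proof. by rewrite -dmneg_bot dmnegK. Qed.

Lemma dmneg_le_join (a b : A) :
  dmneg (Order.meet a b) <= Order.join (dmneg a) (dmneg b).
Proof.
rewrite -[leRHS]dmnegK; apply: dmneg_anti; rewrite lexI.
apply/andP; split; first by rewrite -[leRHS]dmnegK dmneg_anti// leUl.
by rewrite -[leRHS]dmnegK dmneg_anti// leUr.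
Qed.

Lemma dmneg_ge_meet (a b : A) :
  Order.meet (dmneg a) (dmneg b) <= dmneg (Order.join a b).
Proof.
rewrite -[leLHS]dmnegK; apply: dmneg_anti; rewrite leUx.
apply/andP; split; first by rewrite -[leLHS]dmnegK dmneg_anti// leIl.
by rewrite -[leLHS]dmnegK dmneg_anti// leIr.
Qed.

Lemma spec_g_subproof x : is_prime_filter (spec_g_set x).
Proof.
have Px := pf_setP x; split; rewrite /spec_g_set /=.
- by rewrite dmneg_top; exact: (pf_proper Px).
- by move=> a b ab xa xb; apply: xa; exact: (pf_up Px (dmneg_anti _ _ ab) xb).
- move=> a b xa xb xab.
  by case: (pf_prime Px (pf_up Px (dmneg_le_join a b) xab)).
- by rewrite dmneg_bot => /(_ (pf_top Px)).
- move=> a b xab; apply/not_andP => -[xa xb]; apply: xab.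
  exact: (pf_up Px (dmneg_ge_meet a b) (pf_meet Px xa xb)).
Qed.

Definition spec_g x : primeFilter A := PrimeFilter (spec_g_subproof x).

Definition fmul (x y : set A) : set A :=
  [set c | exists a b, [/\ x a, y b & dmmul a b <= c]].

Definition spec_S x y z : Prop := fmul x y `<=` z.

Definition spec_Theta : set (primeFilter A) :=
  [set x : primeFilter A | (x : set A) dmunit].

Definition F0 : dmFrame := @DmFrame (primeFilter A) spec_g spec_S spec_Theta.

End Spectrum.

(* Main.v *)
Require Import Defs.
From mathcomp Require Import all_boot all_order.
From mathcomp Require Import all_classical topology_structure compact.

(** The isomorphism is the Stone map [phi].  A compact open set is some
[phi a]: otherwise the sets [U `\` phi a] with [phi a `<=` U] would generate a
proper filter without cluster point in [U].  For the operations, everything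
rests on the prime filter theorem: if [z] is prime and [x] is a filter, the
elements [v] with [dmmul u v] outside [z] for some [u] in [x] form an ideal, and
a prime filter avoiding it gives the points required by the ternary relation. *)

Set Implicit Arguments.
Unset Strict Implicit.
Unset Printing Implicit Defensive.

Import Order.TTheory.
Local Open Scope order_scope.
Local Open Scope classical_set_scope.

(** * Filters, ideals and the prime filter theorem *)

Section PrimeFilters.
Variables (d : Order.disp_t) (A : tbDistrLatticeType d).
Implicit Types (F I : set A) (a b : A) (x : primeFilter A).

Record is_filter F : Prop := IsFilter {
  filter_top : F \top;
  filter_up : forall a b, a <= b -> F a -> F b;
  filter_meet : forall a b, F a -> F b -> F (Order.meet a b)
}.

Record is_ideal I : Prop := IsIdeal {
  ideal_bot : I \bot;
  ideal_down : forall a b, a <= b -> I b -> I a;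
  ideal_join : forall a b, I a -> I b -> I (Order.join a b)
}.

Lemma prime_is_filter x : is_filter x.
Proof. by case: (pf_setP x) => xT xU xI _ _; split. Qed.

Lemma prime_compl_ideal x : is_ideal [set a | ~ (x : set A) a].
Proof.
case: (pf_setP x) => _ xU _ x0 xP; split => //=.
- by move=> a b ab xb /(xU _ _ ab).
- by move=> a b xa xb /xP[].
Qed.

Lemma principal_filter a : is_filter [set b | a <= b].
Proof.
split=> /=; first exact: lex1.
- by move=> b c bc /le_trans; apply.
- by move=> b c ab ac; rewrite lexI ab.
Qed.

Lemma principal_ideal a : is_ideal [set b | b <= a].
Proof.
split=> /=; first exact: le0x.
- by move=> b c bc; exact: le_trans.
- by move=> b c ba ca; rewrite leUx ba.
Qed.

Lemma filter_adjoin F a : is_filter F ->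
  is_filter [set c | exists2 g, F g & Order.meet g a <= c].
Proof.
case=> FT FU FI; split=> /=.
- by exists \top => //; exact: lex1.
- by move=> b c bc [g Fg gb]; exists g => //; exact: le_trans gb bc.
- move=> b c [g Fg gb] [h Fh hc]; exists (Order.meet g h); first exact: FI.
  rewrite lexI (le_trans _ gb) ?(le_trans _ hc) //.
    by rewrite leI2 ?leIr.
  by rewrite leI2 ?leIl.
Qed.

(** Zorn's lemma yields a filter maximal among those that contain [F] and are disjoint from [I];
    distributivity makes it prime. *)
Lemma prime_filter_avoiding F I : is_filter F -> is_ideal I ->
  (forall a, F a -> ~ I a) ->
  exists x : primeFilter A, F `<=` x /\ forall a, (x : set A) a -> ~ I a.
Proof.
move=> fF [I0 ID IU] FI.
(* The conditions bear on the union of [F] with [X], so that the empty chain, whose union is empty,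
   is covered by [F] itself. *)
pose P := [set X | is_filter (F `|` X) /\ forall a, (F `|` X) a -> ~ I a].
have [C CP Ctot|M [[fG GI] Mmax]] := @Zorn_bigcup A P.
  (* As [C] is a chain, any two elements already lie together in [F] or in one member of the chain
     enlarged by [F]. *)
  have CF a b : (F `|` \bigcup_(X in C) X) a -> (F `|` \bigcup_(X in C) X) b ->
      (F a /\ F b) \/ exists2 X, C X & (F `|` X) a /\ (F `|` X) b.
    move=> [Fa|[X CX Xa]] [Fb|[Y CY Yb]].
    - by left.
    - by right; exists Y => //; split; [left|right].
    - by right; exists X => //; split; [right|left].
    - have [XY|YX] := Ctot _ _ CX CY; right.
      + by exists Y => //; split; right => //; exact: XY.
      + by exists X => //; split; right => //; exact: YX.
  have subC X a : C X -> (F `|` X) a -> (F `|` \bigcup_(X in C) X) a.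
    by move=> CX [Fa|Xa]; [left|right; exists X].
  split; first split.
  - by left; exact: filter_top fF.
  - move=> a b ab Ca; have [[Fa _]|[X CX [Xa _]]] := CF _ _ Ca Ca.
      by left; exact: (filter_up fF) ab Fa.
    by apply: subC (CX) _; exact: (filter_up (CP _ CX).1) ab Xa.
  - move=> a b Ca Cb; have [[Fa Fb]|[X CX [Xa Xb]]] := CF _ _ Ca Cb.
      by left; exact: (filter_meet fF).
    by apply: subC (CX) _; exact: (filter_meet (CP _ CX).1).
  - move=> a Ca; have [[Fa _]|[X CX [Xa _]]] := CF _ _ Ca Ca.
      exact: FI.
    exact: (CP _ CX).2.
set G := F `|` M in fG GI.
(* Otherwise [H], the filter generated by [G] and [a], would avoid [I] and properly contain [M],
   against maximality. *)
have adjoin_meets a : ~ G a -> exists2 g, G g & I (Order.meet g a).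
  move=> Ga; apply: contrapT => noI.
  pose H := [set c | exists2 g, G g & Order.meet g a <= c].
  have GH : G `<=` H by move=> g Gg; exists g => //; exact: leIl.
  apply: (Mmax H).
    split; first by apply: subset_trans GH => ? ?; right.
    move=> /(_ a) HM; apply: Ga; right; apply: HM.
    by exists \top; [exact: filter_top fG|exact: leIr].
  have FH : F `|` H = H.
    by apply/seteqP; split=> [c [Fc|//]|c]; [apply: GH; left|right].
  rewrite /P /mkset FH.
  split; first exact: (filter_adjoin a fG).
  by move=> c [g Gg gc] Ic; apply: noI; exists g => //; exact: ID gc Ic.
have pG : is_prime_filter G.
  case: (fG) => GT GU GM; split=> //.
    by move=> /GI; apply.
  move=> a b Gab; apply: contrapT => /not_orP[/adjoin_meets[g Gg Ia]].
  move=> /adjoin_meets[h Gh Ib].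
  (* This element lies in [G], yet by distributivity it is below the join of two elements of [I],
     the meet of [g] with [a] and that of [h] with [b]. *)
  apply: (GI (Order.meet (Order.meet g h) (Order.join a b))).
    by apply: (GM) => //; exact: GM.
  apply: ID (IU _ _ Ia Ib); rewrite meetUr leU2 // leI2 //.
    exact: leIl.
  exact: leIr.
by exists (PrimeFilter pG); split=> // a Fa; left.
Qed.

(** * The Stone map as a lattice embedding onto the compact open sets *)

Lemma phiI a b : phi (Order.meet a b) = phi a `&` phi b.
Proof.
apply/seteqP; split=> x; case: (prime_is_filter x) => _ xU xI.
  by move=> xab; split; apply: xU xab; [exact: leIl|exact: leIr].
by case; exact: xI.
Qed.

Lemma phiU a b : phi (Order.join a b) = phi a `|` phi b.
Proof.
apply/seteqP; split=> x; first exact: (pf_prime (pf_setP x)).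
have xU := filter_up (prime_is_filter x).
by case; apply: xU; [exact: leUl|exact: leUr].
Qed.

Lemma phi0 : phi (\bot : A) = set0.
Proof. by apply/seteqP; split=> x // /(pf_proper (pf_setP x)). Qed.

Lemma phiT : phi (\top : A) = setT.
Proof. by apply/seteqP; split=> x // _; exact: pf_top (pf_setP x). Qed.

(** If [a] is not below [b], a prime filter separates the up-set of [a] from the down-set of [b]. *)
Lemma phi_sub_le a b : phi a `<=` phi b -> a <= b.
Proof.
move=> ab; apply: contrapT => nab.
have [|x [ax xb]] :=
    prime_filter_avoiding (principal_filter a) (principal_ideal b).
  by move=> c /= ac cb; apply: nab; exact: le_trans ac cb.
exact: xb (ab x (ax a (lexx a))) (lexx b).
Qed.

Lemma phi_inj : injective (@phi d A).
Proof.
by move=> a b ab; apply/eqP; rewrite eq_le !phi_sub_le // ab.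
Qed.

Lemma open_phi a : open (phi a).
Proof. by exists [set phi a]; [move=> _ ->; exists a|rewrite bigcup_set1]. Qed.

Lemma open_phiP (U : set (primeFilter A)) x : open U -> U x ->
  exists2 a, phi a x & phi a `<=` U.
Proof.
case=> D sD <- [V DV Vx]; have [a _ aV] := sD _ DV.
by exists a; rewrite aV // => y Vy; exists V.
Qed.

(* An ultrafilter of sets of prime filters containing [phi a] converges to the
   prime filter of those [b] for which it contains [phi b]. *)
Lemma compact_phi a : compact (phi a).
Proof.
rewrite compact_ultra => /= F FU Fa.
have FF := @ultra_proper _ F FU.
pose y := [set b | F (phi b)].
have py : is_prime_filter y.
  split; rewrite /y /=.
  - by rewrite phiT; exact: filterT.
  - move=> b c bc; apply: filterS => z.
    exact: (filter_up (prime_is_filter z)) bc.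
  - by move=> b c Fb Fc; rewrite phiI; exact: filterI.
  - by rewrite phi0; exact: filter_not_empty.
  - move=> b c; rewrite phiU => Fbc.
    have [|Fnb] := in_ultra_setVsetC (phi b) FU; first by left.
    by right; apply: filterS (filterI Fbc Fnb) => z [[]].
exists (PrimeFilter py); split=> // V; rewrite nbhsE => -[W [Wo Wy] WV].
have [b yb bW] := open_phiP Wo Wy.
by apply: filterS yb; exact: subset_trans bW WV.
Qed.

Lemma compact_open_phi (U : set (primeFilter A)) : compact U -> open U ->
  exists a, U = phi a.
Proof.
move=> Uc Uo; apply: contrapT => nU.
pose F := [set V | exists2 a, phi a `<=` U & U `\` phi a `<=` V].
have FF : ProperFilter F.
  split.
    (* If the empty set were in [F], then [U] would be covered by some [phi a] inside it, hence
       equal to it. *)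
    case=> a aU Ua; apply: nU; exists a; apply/seteqP; split=> // x Ux.
    by apply: contrapT => nax; exact: (Ua x).
  split.
  - by exists \bot => //; rewrite phi0.
  - move=> V W [a aU aV] [b bU bW]; exists (Order.join a b); rewrite phiU.
      by move=> x []; [exact: aU|exact: bU].
    move=> x [Ux /not_orP[nax nbx]]; split; first exact: aV.
    exact: bW.
  - by move=> V W VW [a aU aV]; exists a => //; exact: subset_trans aV VW.
have [|x [Ux Fx]] := Uc F FF.
  by exists \bot; rewrite phi0 // setD0.
(* A basic neighbourhood [phi a] of the cluster point inside [U] misses the member of [F] obtained
   by removing [phi a] from [U]. *)
have [a ax aU] := open_phiP Uo Ux.
have nx : nbhs x (phi a) by apply: open_nbhs_nbhs; split; first exact: open_phi.
have Fa : F (U `\` phi a) by exists a.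
by have [y [[_ nay] ay]] := Fx _ _ Fa nx.
Qed.

End PrimeFilters.

(** * The Stone map and the groupoid operations *)

Section Representation.
Variables (d : Order.disp_t) (A : deMorganGroupoidType d).
Implicit Types (a b c : A) (x y z : primeFilter A).

Lemma dmmul_le a b a' b' : a <= a' -> b <= b' -> dmmul a b <= dmmul a' b'.
Proof.
move=> /join_idPr aa' /join_idPr bb'.
by rewrite -aa' -bb' dmmulUl !dmmulUr -joinA leUl.
Qed.

Lemma spec_S_exists_snd (F : set A) z b : is_filter F ->
  (forall a, F a -> (z : set A) (dmmul a b)) ->
  exists2 y, phi b y & fmul F y `<=` z.
Proof.
move=> [FT FU FI] Fbz; have [z0 zD zU] := prime_compl_ideal z.
have zup := filter_up (prime_is_filter z).
have [||y [by_ yI]] := prime_filter_avoiding (principal_filter b)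
    (I := [set v | exists2 u, F u & ~ (z : set A) (dmmul u v)]).
- split=> /=.
  + by exists \top => //; rewrite dmmul0.
  + move=> v w vw [u Fu uw]; exists u => //.
    by apply: zD uw; exact: dmmul_le.
  + move=> v w [u Fu uv] [u' Fu' uw]; exists (Order.meet u u'); first exact: FI.
    (* Primeness of [z] enters here: a join of two elements outside [z] is outside [z]. *)
    rewrite dmmulUr; apply: zU.
      by apply: zD uv; apply: dmmul_le => //; exact: leIl.
    by apply: zD uw; apply: dmmul_le => //; exact: leIr.
- move=> v /= bv [u Fu]; apply; apply: zup (Fbz _ Fu).
  exact: dmmul_le.
exists y; first by apply: by_ => /=.
move=> c [u [v [Fu yv uvc]]]; apply: zup uvc _.
by apply: contrapT => nuv; apply: (yI v yv); exists u.
Qed.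

(** The first factor is enlarged to a prime filter while [b] stays fixed; the result is the input
    that [spec_S_exists_snd] needs to enlarge [b]. *)
Lemma spec_S_exists_fst z a b : (z : set A) (dmmul a b) ->
  exists2 x, phi a x & forall u, (x : set A) u -> (z : set A) (dmmul u b).
Proof.
move=> zab; have [z0 zD zU] := prime_compl_ideal z.
have zup := filter_up (prime_is_filter z).
have [||x [ax xI]] := prime_filter_avoiding (principal_filter a)
    (I := [set u | ~ (z : set A) (dmmul u b)]).
- split=> /=.
  + by rewrite dm0mul.
  + by move=> u v uv; apply: zD; exact: dmmul_le.
  + by move=> u v zu zv; rewrite dmmulUl; exact: zU.
- by move=> u /= au; apply; apply: zup zab; exact: dmmul_le.
exists x; first by apply: ax => /=.
by move=> u /xI /contrapT.
Qed.

Lemma phi_neg a : phi (dmneg a) = co_neg (X := F0 A) (phi a).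
Proof. by apply/seteqP; split=> x; [move=> xa|move=> /contrapT]. Qed.

Lemma phi_mul a b : phi (dmmul a b) = co_mul (X := F0 A) (phi a) (phi b).
Proof.
apply/seteqP; split=> z.
  move=> /spec_S_exists_fst[x ax xz].
  have [y yb xyz] := spec_S_exists_snd (prime_is_filter x) xz.
  by exists x, y.
by case=> x [y [xyz ax by_]]; apply: xyz; exists a, b.
Qed.

Lemma phi_imp a b : phi (dmimp a b) = co_imp (X := F0 A) (phi a) (phi b).
Proof.
apply/seteqP; split=> x.
  move=> xab y z [xyz ya]; apply: xyz; exists (dmimp a b), a; split=> //.
  exact/dmmul_residual.
move=> xab; apply: contrapT => nx.
have [xT xU xI] := prime_is_filter x.
(* The filter generated by the products of elements of [x] with [a] avoids the down-set of [b]: by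
   residuation, a product below [b] would put [dmimp a b] in [x]. *)
have [||z [xaz nz]] := @prime_filter_avoiding d A
    [set c | exists2 u, (x : set A) u & dmmul u a <= c] _ _ (principal_ideal b).
- split=> /=.
  + by exists \top => //; exact: lex1.
  + by move=> c e ce [u xu uc]; exists u => //; exact: le_trans uc ce.
  + move=> c e [u xu uc] [v xv ve]; exists (Order.meet u v); first exact: xI.
    rewrite lexI; apply/andP; split.
      by apply: le_trans uc; apply: dmmul_le => //; exact: leIl.
    by apply: le_trans ve; apply: dmmul_le => //; exact: leIr.
- move=> c /= [u xu uc] cb; apply: nx; apply: xU xu.
  by apply/dmmul_residual; exact: le_trans uc cb.
have [|y ya xyz] := @spec_S_exists_snd x z a (prime_is_filter x).
  by move=> u xu; apply: xaz; exists u.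
exact: nz (xab y z (conj xyz ya)) (lexx b).
Qed.

Lemma compact_openP (U : set (F0 A)) :
  compact_open U <-> exists a, U = phi a.
Proof.
split=> [[]|[a ->]]; first exact: compact_open_phi.
by split; [exact: compact_phi|exact: open_phi].
Qed.

Lemma F0_closed : co_closed (F0 A).
Proof.
split.
- move=> _ _ /compact_openP[a ->] /compact_openP[b ->]; apply/compact_openP.
  by exists (Order.meet a b); rewrite phiI.
- move=> _ _ /compact_openP[a ->] /compact_openP[b ->]; apply/compact_openP.
  by exists (Order.join a b); rewrite phiU.
- move=> _ /compact_openP[a ->]; apply/compact_openP.
  by exists (dmneg a); rewrite phi_neg.
- move=> _ _ /compact_openP[a ->] /compact_openP[b ->]; apply/compact_openP.
  by exists (dmmul a b); rewrite phi_mul.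
- move=> _ _ /compact_openP[a ->] /compact_openP[b ->]; apply/compact_openP.
  by exists (dmimp a b); rewrite phi_imp.
(* [spec_Theta] is [phi dmunit] by definition. *)
- by apply/compact_openP; exists dmunit.
- by apply/compact_openP; exists \bot; rewrite phi0.
- by apply/compact_openP; exists \top; rewrite phiT.
Qed.

Lemma phi_compact_open a : compact_open (phi a : set (F0 A)).
Proof. by apply/compact_openP; exists a. Qed.

End Representation.

Theorem theorem4p9 (d : Order.disp_t) (A : deMorganGroupoidType d) :
  exists H : co_closed (F0 A), dmIsomorphic (dmAlgebra_of A) (G0 H).
Proof.
exists (F0_closed A).
exists (fun a : A => exist _ _ (phi_compact_open a) : G0 (F0_closed A)).
  rewrite -setTT_bijective; split=> //.
    by move=> a b _ _ /(congr1 sval) /phi_inj.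
  move=> [U coU] _; have /compact_openP[a Ua] := coU.
  by exists a => //; exact: eq_exist.
(* By proof irrelevance, equality of compact opens is equality of the underlying sets. *)
split=> *; apply: eq_exist.
- exact: phiI.
- exact: phiU.
- exact: phi_neg.
- exact: phi_mul.
- exact: phi_imp.
- by [].
- exact: phi0.
- exact: phiT.
Qed.
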